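(* Let $E$ be a real Banach space, let $U\subset E$ be open, $x_0\in U$, and let $f_i:U\to\mathbb{R}$, $i=1,\dots,\kappa$, be of class $C^1$ in a neighbourhood of $x_0$. Assume that the constant rank condition holds at $x_0$ with a neighbourhood $V(x_0)$, i.e. $$\operatorname{rank}\{Df_i(x),\ i=1,\dots,\kappa\}=\operatorname{rank}\{Df_i(x_0),\ i=1,\dots,\kappa\}=k\quad\text{for all }x\in V(x_0).$$ Let $i_1,\dots,i_k\in\{1,\dots,\kappa\}$ be pairwise distinct indices such that $Df_{i_1}(x_0),\dots,Df_{i_k}(x_0)$ are linearly independent. (1) If $k=\kappa$, then $f_1,\dots,f_\kappa$ are functionally independent at $x_0$. (2) If $k<\kappa$, then for any $l\in\{1,\dots,\kappa\}\setminus\{i_1,\dots,i_k\}$ the functions $f_{i_1},\dots,f_{i_k},f_l$ are functionally dependent at $x_0$, and there exists a function $g_l:\mathbb{R}^k\to\mathbb{R}$ of class $C^1$ such that for all $x$ in some neighbourhood of $x_0$ $$f_l(x)=g_l(f_{i_1}(x),\dots,f_{i_k}(x)).$$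
   Context: $Df_i(x)\in E^*$ denotes the Fréchet derivative. The rank of a finite family of vectors is the cardinality of a maximal linearly independent subfamily. Functional dependence: let $f_1,\dots,f_m:U\to\mathbb{R}$ be of class $C^1$ in a neighbourhood of $x_0\in U$ and put $y_0:=(f_1(x_0),\dots,f_m(x_0))\in\mathbb{R}^m$. They are functionally dependent at $x_0$ if there exist neighbourhoods $U(x_0)$ of $x_0$ and $V(y_0)$ of $y_0$ (with $(f_1,\dots,f_m)(U(x_0))\subset V(y_0)$, so that the composition makes sense) and a function $F:V(y_0)\to\mathbb{R}$ of class $C^1$ such that $F(f_1(x),\dots,f_m(x))=0$ for all $x\in U(x_0)$ and $DF(y_0)\neq 0$. They are functionally independent at $x_0$ if they are not functionally dependent at $x_0$. *)

(* Defs.v *)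
From HB Require Import structures.
From mathcomp Require Import all_boot all_order all_algebra.
From mathcomp Require Import all_classical all_reals all_analysis.
Import numFieldNormedType.Exports.

Set Implicit Arguments.
Unset Strict Implicit.
Unset Printing Implicit Defensive.

Local Open Scope classical_set_scope.
Local Open Scope ring_scope.

Definition lin_indep (R : realType) (V : lmodType R) (I : finType)
    (v : I -> V) : Prop :=
  forall c : I -> R, \sum_i c i *: v i = 0 -> forall i, c i = 0.

(* A subfamily is given by its set of indices. The rank is stated as a relation;
   all inclusion-maximal independent subfamilies have the same cardinality, so
   at most one r satisfies it. *)
Definition has_rank (R : realType) (V : lmodType R) (I : finType)
    (v : I -> V) (r : nat) : Prop :=
  exists2 J : {set I},
    maxset (fun J => `[< lin_indep (fun j : {i | i \in J} => v (val j)) >]) J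
    & #|J| = r.

Section functional_dependence.
Context {R : realType} {E : normedModType R}.

(* The second condition says that the operator norm of Df(y) - Df(x) is at most
   e, i.e. that Df : A -> E^* is continuous. Functions on A are represented by
   total functions; A being open, the values outside A are irrelevant. *)
Definition C1_on (A : set E) (f : E -> R) : Prop :=
  [/\ open A,
      forall x, A x -> differentiable f x &
      forall x, A x -> forall e : R, 0 < e ->
        \forall y \near x, forall h : E, `|'d f y h - 'd f x h| <= e * `|h|].

Definition C1_near (U : set E) (f : E -> R) (x0 : E) : Prop :=
  exists A : set E, [/\ A x0, A `<=` U & C1_on A f].

(* Df_i(x), seen in the space of all functions E -> R, of which E^* is a
   linear subspace *)
Definition differentials (I : finType) (f : I -> E -> R) (x : E) (i : I) :
    E -> R :=
  'd (f i) x.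

Definition constant_rank (I : finType) (U : set E) (f : I -> E -> R) (x0 : E)
    (V : set E) (k : nat) : Prop :=
  [/\ nbhs x0 V, V `<=` U &
      forall x, V x ->
        (forall i, differentiable (f i) x) /\ has_rank (differentials f x) k].

Definition joint (m : nat) (f : 'I_m -> E -> R) (x : E) : 'rV[R]_m :=
  \row_i f i x.

(* f_{i_1}, ..., f_{i_k}, f_l *)
Definition append_fun (k m : nat) (f : 'I_m -> E -> R) (i : 'I_k -> 'I_m)
    (l : 'I_m) (j : 'I_k.+1) : E -> R :=
  if unlift ord_max j is Some j' then f (i j') else f l.

End functional_dependence.

(* Finite-dimensional spaces 'rV[R]_m carry the sup norm. *)
Definition functionally_dependent (R : realType) (E : normedModType R)
    (U : set E) (m : nat) (f : 'I_m -> E -> R) (x0 : E) : Prop :=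
  exists (A : set E) (B : set 'rV[R]_m) (F : 'rV[R]_m -> R),
    [/\ nbhs x0 A /\ A `<=` U,
        B (joint f x0) /\ joint f @` A `<=` B,
        C1_on B F,
        forall x, A x -> F (joint f x) = 0 &
        'd F (joint f x0) <> 0 :> ('rV[R]_m -> R)].

Definition functionally_independent (R : realType) (E : normedModType R)
    (U : set E) (m : nat) (f : 'I_m -> E -> R) (x0 : E) : Prop :=
  ~ functionally_dependent U f x0.

(* Main.v *)
(* Let G_j = f_{i_j} and L_j = DG_j(x0), with dual vectors e_j. The map
   Phi x = x + sum_j (G_j x - G_j x0 - L_j (x - x0)) e_j
   has derivative the identity at x0 and satisfies G = G x0 + L (Phi - x0). Its
   local inverse Psi is only needed to be Lipschitz, which the contraction
   principle gives: constant rank yields Df_l = sum_i a_i DG_i near x0 with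
   continuous a_i, and then f_l o Psi is differentiable at z with derivative
   sum_i a_i(Psi z) L_i because G o Psi is affine. So f_l o Psi is constant
   along ker L, hence a function of G, whose gradient is a o Psi; composing
   with a C^1 truncation of the coordinates makes it globally defined. When
   k = kappa, DF(y0) vanishes on every (L_i(e_j))_i, that is, on the standard
   basis. *)
Require Import Defs.
From HB Require Import structures.
From mathcomp Require Import all_boot all_order all_algebra.
From mathcomp Require Import all_classical all_reals all_analysis.
From mathcomp Require Import ring lra.
Import Order.TTheory GRing.Theory Num.Theory.
Import numFieldNormedType.Exports.

Set Implicit Arguments.
Unset Strict Implicit.
Unset Printing Implicit Defensive.

Local Open Scope classical_set_scope.
Local Open Scope ring_scope.

(** * First-order approximation and the mean value theorem on segments *)

Lemma diff_approx (R : realType) (V W : normedModType R) (f : V -> W) (x : V) :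
  differentiable f x -> forall e : R, 0 < e ->
  \forall y \near x, `|f y - f x - 'd f x (y - x)| <= e * `|y - x|.
Proof.
move=> /diff_locallyP[_ /eqaddoP fx] e e0.
have := fx _ e0; rewrite (near_shift 0 x) /=.
by apply: filterS => y; rewrite /= subr0 !fctE/= addrK opprD addrA.
Qed.

Lemma is_diff_approx (R : realType) (V W : normedModType R) (f df : V -> W)
    (x : V) : linear df -> continuous df ->
  (forall e : R, 0 < e ->
     \forall y \near x, `|f y - f x - df (y - x)| <= e * `|y - x|) ->
  is_diff x f df.
Proof.
move=> dflin dfcont fx.
pose L : {linear V -> W} := HB.pack df (GRing.isLinear.Build _ _ _ _ df dflin).
have fL : f \o shift x = cst (f x) + L +o_ 0 id.
  apply/eqaddoP => e e0; have := fx _ e0; rewrite (near_shift 0 x) /=.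
  by apply: filterS => y; rewrite /= subr0 !fctE/= addrK opprD addrA.
have dfx : 'd f x = L :> (V -> W) by exact: diff_unique.
by apply: DiffDef => //; apply/diff_locallyP; split; rewrite dfx.
Qed.

Lemma mean_value_segment (R : realType) (V : normedModType R) (f : V -> R)
    (x v : V) :
  (forall t : R, 0 <= t <= 1 -> differentiable f (x + t *: v)) ->
  exists2 t : R, 0 <= t <= 1 & f (x + v) - f x = 'd f (x + t *: v) v.
Proof.
move=> fd.
pose u (t : R) := f (x + t *: v).
have ud (t : R) : 0 <= t <= 1 -> is_diff t u (fun s => 'd f (x + t *: v) (s *: v)).
  move=> t01; have fdt := fd _ t01.
  have dl : is_diff t (fun t : R => x + t *: v) (fun s : R => s *: v).
    have -> : (fun s : R => s *: v) = 0 + *:%R ^~ v by rewrite add0r.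
    exact: is_diffD.
  have df := differentiableP fdt.
  exact: (@is_diff_comp _ _ _ _ (fun t : R => x + t *: v) _ f).
have [||c c01 uc] := @MVT R u (fun t => 'd f (x + t *: v) v) 0 1 ltr01.
- move=> t; rewrite in_itv/= => /andP[t0 t1].
  have t01 : 0 <= t <= 1 by rewrite !ltW.
  have := ud _ t01 => ?; apply: DeriveDef; first exact: diff_derivable.
  by rewrite deriveE// diff_val scale1r.
- apply: derivable_within_continuous => t; rewrite in_itv/= => t01.
  by have := ud _ t01 => ?; exact: diff_derivable.
exists c; first by move: c01; rewrite in_itv/= => /andP[/ltW -> /ltW ->].
by move: uc; rewrite /u scale1r scale0r addr0 subr0 mulr1.
Qed.

Lemma near_normP (R : realType) (V : normedModType R) (x : V) (P : set V) :
  (\forall y \near x, P y) <->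
  exists2 r : R, 0 < r & forall y, `|y - x| < r -> P y.
Proof.
split.
  by move=> /nbhs_normP[r/= r0 rP]; exists r => // y yx; apply: rP => /=; rewrite distrC.
by move=> [r r0 rP]; apply/nbhs_normP; exists r => //= y/= yx; apply: rP; rewrite distrC.
Qed.

(** * Straightening [G] by a Lipschitz local inverse *)

(** A solution is a fixed point of [x |-> z - phi x]. This map preserves the closed ball of radius
    [r]: [z] lies within [r / 2] of the centre and [phi], vanishing there and [2^-1]-Lipschitz,
    moves it by at most another [r / 2]. *)
Lemma lipschitz_perturbation_id_surj (R : realType)
    (E : completeNormedModType R) (phi : E -> E) (x0 z : E) (r : R) :
  0 < r -> phi x0 = 0 ->
  (forall x y, `|x - x0| <= r -> `|y - x0| <= r ->
     `|phi x - phi y| <= 2^-1 * `|x - y|) ->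
  `|z - x0| <= r / 2 ->
  exists x, `|x - x0| <= r /\ x + phi x = z.
Proof.
move=> r0 phi0 phil zr.
pose C : set E := closed_ball_ Num.norm x0 r.
have Cx0 : C x0 by rewrite /C /closed_ball_/= subrr normr0 ltW.
have CP x : C x <-> `|x - x0| <= r by rewrite /C /closed_ball_/= distrC.
have hC : set_fun C C (fun x => z - phi x).
  move=> x /CP xr; apply/CP.
  have -> : z - phi x - x0 = (z - x0) - (phi x - phi x0).
    by rewrite phi0 subr0 addrAC.
  rewrite (le_trans (ler_normB _ _))//.
  have : `|x0 - x0| <= r by apply/CP.
  by move=> /(phil _ _ xr); lra.
have q0 : 0 <= 2^-1 :> R by rewrite invr_ge0.
have contr : is_contraction (mkfun_fun hC).
  exists (NngNum q0); split=> /=; first by lra.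
  move=> [x y] [/= /CP Cx /CP Cy]; rewrite /mkfun/=.
  have -> : z - phi x - (z - phi y) = phi y - phi x.
    by rewrite opprB addrC addrA subrK.
  by rewrite distrC phil.
have [||x Cx xE] := @banach_fixed_point R E C (mkfun_fun hC) contr.
- exact: closed_closed_ball_.
- by exists x0.
exists x; split; first exact/CP.
by rewrite {1}xE /= /mkfun subrK.
Qed.

Lemma normB_segment_lt (R : realType) (V : normedModType R) (x0 x y : V)
    (r t : R) : `|x - x0| < r -> `|y - x0| < r -> 0 <= t <= 1 ->
  `|y + t *: (x - y) - x0| < r.
Proof.
move=> xr yr /andP[t0 t1].
have -> : y + t *: (x - y) - x0 = (1 - t) *: (y - x0) + t *: (x - x0).
  rewrite scalerBl scale1r -[RHS]addrA [- (t *: _) + _]addrC -scalerBr.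
  by rewrite [- (y - x0)]opprB [x - x0 + _]addrA subrK addrAC.
rewrite (le_lt_trans (ler_normD _ _))// !normrZ !ger0_norm ?subr_ge0//.
have [->|tn0] := eqVneq t 0; first by rewrite mul0r addr0 subr0 mul1r.
have tp : 0 < t by rewrite lt0r tn0.
rewrite (_ : r = (1 - t) * r + t * r); last by ring.
by rewrite ler_ltD ?ltr_pM2l// ler_wpM2l ?subr_ge0// ltW.
Qed.

(* [x + \sum_i (G_i x - G_i x0 - DG_i(x0)(x - x0)) e_i] is a small perturbation
   of the identity through which [G] becomes affine; [Psi] is its inverse. *)
Lemma straightening (R : realType) (E : completeNormedModType R) (k : nat)
    (G : 'I_k -> E -> R) (x0 : E) (e : 'I_k -> E) (W : set E) :
  (forall i, \forall x \near x0, differentiable (G i) x) ->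
  (forall i (eta : R), 0 < eta ->
     \forall x \near x0, forall h, `|'d (G i) x h - 'd (G i) x0 h| <= eta * `|h|) ->
  (forall i j, 'd (G i) x0 (e j) = (i == j)%:R) ->
  nbhs x0 W ->
  exists (r : R) (Psi : E -> E),
    [/\ 0 < r,
        forall z, `|z - x0| < r -> W (Psi z) /\
          forall i, G i (Psi z) = G i x0 + 'd (G i) x0 (z - x0),
        forall z z', `|z - x0| < r -> `|z' - x0| < r ->
          `|Psi z - Psi z'| <= 2 * `|z - z'| &
        \forall x \near x0, exists2 z, `|z - x0| < r & Psi z = x].
Proof.
move=> Gd Gc dual W0.
(* The summand [1] keeps [S] positive even when the family is empty; the same device recurs
   below. *)
pose S := 1 + \sum_j `|e j|.
have S0 : 0 < S by rewrite ltr_pwDl// sumr_ge0.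
(* Chosen so that [eta * S = 2^-1], the Lipschitz constant wanted for [phi]. *)
pose eta := (2 * S)^-1.
have eta0 : 0 < eta by rewrite invr_gt0 mulr_gt0.
have : \forall x \near x0, W x /\ forall i, differentiable (G i) x /\
    forall h, `|'d (G i) x h - 'd (G i) x0 h| <= eta * `|h|.
  apply: filterI => //; apply: filter_forall => i.
  by apply: filterI; [exact: Gd|exact: Gc].
move=> /near_normP[r0 r00 nr0].
have Gl i x y : `|x - x0| < r0 -> `|y - x0| < r0 ->
    `|G i x - G i y - 'd (G i) x0 (x - y)| <= eta * `|x - y|.
  move=> xr yr.
  have seg t : 0 <= t <= 1 -> `|y + t *: (x - y) - x0| < r0.
    exact: normB_segment_lt.
  have [t t01 Gt] := @mean_value_segment _ _ (G i) y (x - y)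
     (fun t t01 => ((nr0 _ (seg _ t01)).2 i).1).
  rewrite subrKC in Gt; rewrite Gt.
  exact: ((nr0 _ (seg _ t01)).2 i).2.
pose phi x := \sum_i (G i x - G i x0 - 'd (G i) x0 (x - x0)) *: e i.
have phi0 : phi x0 = 0.
  by rewrite /phi big1// => i _; rewrite !subrr linear0 subr0 scale0r.
have phil x y : `|x - x0| < r0 -> `|y - x0| < r0 ->
    `|phi x - phi y| <= 2^-1 * `|x - y|.
  move=> xr yr; rewrite /phi -sumrB.
  have -> : 2^-1 * `|x - y| = eta * S * `|x - y|.
    by rewrite /eta invfM mulfVK ?gt_eqF.
  rewrite (le_trans (ler_norm_sum _ _ _))//.
  rewrite (@le_trans _ _ (\sum_i eta * `|x - y| * `|e i|))//.
    apply: ler_sum => i _; rewrite -scalerBl normrZ ler_wpM2r//.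
    have -> : G i x - G i x0 - 'd (G i) x0 (x - x0) -
      (G i y - G i x0 - 'd (G i) x0 (y - x0)) =
      G i x - G i y - 'd (G i) x0 (x - y).
      by rewrite !linearB/=; ring.
    exact: Gl.
  rewrite -mulr_sumr -[leRHS]mulrAC ler_wpM2l ?mulr_ge0 ?(ltW eta0)//.
  by rewrite /S lerDr.
(* The radius is halved twice: [r0 / 2] stays strictly inside the ball where [phi] is controlled,
   and solvability there requires [z] within [r0 / 4]. Elsewhere [x0] is a default value, so that
   [choice] applies. *)
have inv z : exists x, `|z - x0| < r0 / 4 -> `|x - x0| <= r0 / 2 /\ x + phi x = z.
  have [zr|nzr] := boolP (`|z - x0| < r0 / 4); last by exists x0.
  have [|x y xr yr||x xz] := @lipschitz_perturbation_id_surj R E phi x0 z (r0 / 2) _ phi0.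
  - by lra.
  - by apply: phil; lra.
  - by lra.
  - by exists x.
have [Psi PsiP] := choice inv.
(* The map [x + phi x] shrinks distances by a factor of at most 2. This makes it injective and its
   inverse 2-Lipschitz. *)
have phib x y : `|x - x0| <= r0 / 2 -> `|y - x0| <= r0 / 2 ->
    `|x - y| <= 2 * `|(x + phi x) - (y + phi y)|.
  move=> xr yr.
  have : `|phi x - phi y| <= 2^-1 * `|x - y| by apply: phil; lra.
  have := ler_normB (x + phi x - (y + phi y)) (phi x - phi y).
  have -> : x + phi x - (y + phi y) - (phi x - phi y) = x - y.
    by rewrite opprD addrACA addrK.
  lra.
exists (r0 / 4), Psi; split.
- by lra.
- move=> z zr; have [Pr Pz] := PsiP _ zr; split; first by apply: (nr0 _ _).1; lra.
  (* Write [z = x + phi x] with [x = Psi z]. By duality, applying [DG_i(x0)] to [phi x] extracts the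
     [i]-th coefficient, whose linear term cancels [DG_i(x0) (x - x0)]. *)
  move=> i; rewrite -{2}Pz addrAC linearD/= /phi linear_sum/=.
  rewrite (bigD1 i)//= big1 => [|j ji]; last first.
    by rewrite linearZ/= dual eq_sym (negbTE ji) scaler0.
  by rewrite linearZ/= dual eqxx /GRing.scale/=; ring.
- move=> z z' zr z'r; have [Pr Pz] := PsiP _ zr; have [Pr' Pz'] := PsiP _ z'r.
  by rewrite -{2}Pz -{2}Pz'; exact: phib.
(* Passing from [x] to [x + phi x] multiplies the distance to [x0] by at most 3/2, so [r0 / 8] lands
   inside [r0 / 4]. Then [Psi] returns [x] by injectivity. *)
apply/near_normP; exists (r0 / 8); first by lra.
move=> x xr; have zr : `|x + phi x - x0| < r0 / 4.
  have : `|phi x - phi x0| <= 2^-1 * `|x - x0|.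
    by apply: phil; rewrite ?subrr ?normr0; lra.
  rewrite phi0 subr0 => h.
  rewrite addrAC (le_lt_trans (ler_normD _ _))//; lra.
exists (x + phi x) => //; have [Pr Pz] := PsiP _ zr.
apply/subr0_eq/normr0_eq0/eqP; rewrite eq_le normr_ge0 andbT.
rewrite (le_trans (phib _ _ Pr _))//; first by lra.
by rewrite Pz subrr normr0 mulr0.
Qed.

(** * A bounded C^1 function that is the identity near 0 *)

(* Beyond [|t| = 1] the identity is continued by [2 - 1 / t] and its odd image. *)
Lemma C1_truncation1 (R : realType) :
  exists p p' : R -> R,
    [/\ forall t, `|t| <= 1 -> p t = t,
        forall t, `|p t| <= 2,
        continuous p' &
        forall t u, `|p u - p t - p' t * (u - t)| <= (u - t) ^+ 2].
Proof.
pose p (t : R) := if t < -1 then - 2 - t^-1 else if t <= 1 then t else 2 - t^-1.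
(* The derivative of [p] is 1 inside and [t^-2] outside; the maximum writes both at once and makes
   continuity immediate. *)
pose n (t : R) := Num.max 1 `|t|.
pose p' (t : R) := (n t * n t)^-1.
have pN t : p (- t) = - p t.
  by rewrite /p; case: (ltP (- t) (- 1)); case: (ltP t (- 1));
    case: (leP (- t) 1); case: (leP t 1); rewrite ?invrN; lra.
have pin t : `|t| <= 1 -> p t = t.
  by rewrite ler_norml => /andP[t0 t1]; rewrite /p ltNge t0 t1.
(* The inverse is named [w] with [t * w = 1], so that the identities below are polynomial modulo
   this relation. *)
have pgt t : 1 < t -> exists w, [/\ t * w = 1, 0 < w, w <= 1, p t = 2 - w & p' t = w * w].
  move=> t1; exists t^-1; have t0 : 0 < t by lra.
  split; first by rewrite mulfV ?gt_eqF.
  - by rewrite invr_gt0.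
  - by rewrite invf_le1 ?ltW.
  - by rewrite /p ifF ?ifF//; lra.
  - by rewrite /p' /n gtr0_norm// max_r ?ltW// invfM.
have p'in t : `|t| <= 1 -> p' t = 1.
  by move=> t1; rewrite /p' /n max_l// mulr1 invr1.
have p'N t : p' (- t) = p' t by rewrite /p' /n normrN.
exists p, p'; split => //.
- move=> t; wlog t0 : t / 0 <= t.
    by move=> h; case: (leP 0 t) => [/h//|t0]; rewrite -normrN -pN h//; lra.
  have [t1|t1] := leP t 1; first by rewrite pin ger0_norm//; lra.
  have [w [_ w0 w1 -> _]] := pgt _ t1; rewrite ger0_norm; lra.
- have nc : continuous n.
    move=> t; apply: (@continuous_max _ _ (cst 1) (fun t => `|t|)).
      exact: cst_continuous.
    exact: norm_continuous.
  move=> t; apply: (@continuousV _ _ (fun t => n t * n t)).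
    by rewrite gt_eqF// mulr_gt0// /n lt_max ltr01.
  by apply: continuousM; exact: nc.
(* [p] is odd and [p'] is even, so [t] may be taken nonnegative; [u] can still lie in any of the
   three regions. *)
move=> t u; wlog t0 : t u / 0 <= t.
  move=> h; case: (leP 0 t) => [/h//|t0].
  have := h (- t) (- u); rewrite !pN p'N => /(_ _)/=.
  have -> : - p u - - p t - p' t * (- u - - t) = - (p u - p t - p' t * (u - t)).
    by ring.
  have -> : (- u - - t) ^+ 2 = (u - t) ^+ 2 by ring.
  by rewrite normrN; apply; lra.
have [t1|t1] := leP t 1.
  have tt : `|t| <= 1 by rewrite ger0_norm.
  rewrite (p'in t)// (pin t)// mul1r.
  have [u1|u1] := leP u 1; last first.
    have [v [uv v0 v1 -> _]] := pgt _ u1.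
    have -> : 2 - v - t - (u - t) = - (v * (u - 1) ^+ 2).
      by transitivity (2 * (u * v) - v - u * (u * v)); [rewrite uv|]; ring.
    rewrite normrN ger0_norm; last by rewrite mulr_ge0 ?sqr_ge0// ltW.
    rewrite (@le_trans _ _ ((u - 1) ^+ 2)) ?ler_piMl ?sqr_ge0//.
    by rewrite ler_sqr ?nnegrE; lra.
  have [u2|u2] := leP (-1) u.
    rewrite pin; last by rewrite ler_norml u2.
    by rewrite subrr normr0 sqr_ge0.
  have [|v [uv v0 v1 pu _]] := pgt (- u); first by lra.
  have -> : p u = v - 2 by rewrite -[u]opprK pN pu; ring.
  have -> : v - 2 - t - (u - t) = v * (u + 1) ^+ 2.
    by transitivity (v + 2 * - (- u * v) + u * - (- u * v)); [rewrite uv|]; ring.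
  rewrite ger0_norm; last by rewrite mulr_ge0 ?sqr_ge0// ltW.
  rewrite (@le_trans _ _ ((u + 1) ^+ 2)) ?ler_piMl ?sqr_ge0//.
  by rewrite -(sqrrN (u + 1)) -(sqrrN (u - t)) ler_sqr ?nnegrE; lra.
have [w [tw w0 w1 -> ->]] := pgt _ t1.
have [u1|u1] := leP u 1; last first.
  have [v [uv v0 v1 -> _]] := pgt _ u1.
  have -> : 2 - v - (2 - w) - w * w * (u - t) = - (w * w * v * (u - t) ^+ 2).
    transitivity (w - v - w * w * u + w * (t * w)); first by ring.
    transitivity (- (w * w * u * (u * v) - 2 * w * (t * w) * (u * v) +
       (t * w) * (t * w) * v)); last by ring.
    by rewrite uv tw; ring.
  have wwv0 : 0 <= w * w * v by rewrite !mulr_ge0 ?(ltW w0) ?(ltW v0).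
  have wwv1 : w * w * v <= 1.
    by rewrite !mulr_ile1 ?mulr_ge0 ?(ltW w0) ?(ltW v0).
  rewrite normrN normrM (ger0_norm wwv0) ger0_norm ?sqr_ge0//.
  by rewrite ler_piMl ?sqr_ge0.
have [u2|u2] := leP (-1) u.
  rewrite pin; last by rewrite ler_norml u2.
  have -> : u - (2 - w) - w * w * (u - t) =
      - ((1 - u) * (t - 1) * (w * (1 + w)) + (t - 1) ^+ 2 * (w * w)).
    transitivity (- ((1 - u) * ((t * w) - w + w * (t * w) - w * w)
      + (t * w) ^+ 2 - 2 * w * (t * w) + w * w)); last by ring.
    transitivity (u - (2 - w) - w * w * u + w * (t * w)); first by ring.
    by rewrite tw; ring.
  rewrite normrN ger0_norm; last first.
    by rewrite addr_ge0// !mulr_ge0 ?sqr_ge0//; lra.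
  (* Since [0 < w <= 1], [w * (1 + w) <= 2] and [w * w <= 1]. The resulting bound is
     [((1 - u) + (t - 1))^2 - (1 - u)^2], at most [(u - t)^2]. *)
  apply: (@le_trans _ _ ((1 - u) * (t - 1) * 2 + (t - 1) ^+ 2 * 1)).
    rewrite lerD// ler_wpM2l ?sqr_ge0 ?mulr_ge0//; try lra; nra.
  nra.
(* Here [t - u > 2], hence both 4 and [t - u] are below [(t - u)^2] and crude bounds suffice. *)
have [|v [uv v0 v1 pu _]] := pgt (- u); first by lra.
have -> : p u = v - 2 by rewrite -[u]opprK pN pu; ring.
have h1 : 0 <= w * w * (t - u) by rewrite !mulr_ge0 ?(ltW w0)//; lra.
have h2 : w * w * (t - u) <= t - u.
  by rewrite ler_piMl ?mulr_ile1 ?(ltW w0)//; lra.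
rewrite ler_norml; apply/andP; split; nra.
Qed.

(** Rescaling [d * p (t / d)] of the previous function. The last bound identifies [s'] as the
    derivative, with a quadratic remainder uniform in [t]. *)
Lemma C1_truncation (R : realType) (d : R) : 0 < d ->
  exists s s' : R -> R,
    [/\ forall t, `|t| <= d -> s t = t,
        forall t, `|s t| <= 2 * d,
        continuous s' &
        forall t u, `|s u - s t - s' t * (u - t)| <= d^-1 * (u - t) ^+ 2].
Proof.
move=> d0; have [p [p' [p1 p2 p'c pp]]] := C1_truncation1 R.
exists (fun t => d * p (d^-1 * t)), (fun t => p' (d^-1 * t)); split.
- move=> t td; rewrite p1 ?mulVKf ?gt_eqF// normrM gtr0_norm ?invr_gt0//.
  by rewrite mulrC ler_pdivrMr ?mul1r.
- by move=> t; rewrite normrM gtr0_norm// mulrC ler_pM2r.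
- by move=> t; apply: continuous_comp; [exact: mulrl_continuous|exact: p'c].
move=> t u; have := pp (d^-1 * t) (d^-1 * u); rewrite -(ler_pM2l d0).
rewrite -{1}(gtr0_norm d0) -normrM.
have -> : d * (p (d^-1 * u) - p (d^-1 * t) - p' (d^-1 * t) * (d^-1 * u - d^-1 * t))
  = d * p (d^-1 * u) - d * p (d^-1 * t) - p' (d^-1 * t) * (u - t).
  by field; rewrite gt_eqF.
by move=> /le_trans; apply; rewrite le_eqVlt; apply/orP; left; apply/eqP; field;
  rewrite gt_eqF.
Qed.

(** * Factorization of [f] through [G] *)

Lemma ler_coord_norm (R : realType) (m n : nat) (A : 'M[R]_(m, n)) i j :
  `|A i j| <= `|A|.
Proof.
rewrite [leRHS]/Num.norm/= mx_normrE.
exact: (@le_bigmax _ _ _ 0 (fun ij : 'I_m * 'I_n => `|A ij.1 ij.2|) (i, j)).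
Qed.

Lemma continuous_lincomb (R : realType) (V : normedModType R) (k : nat)
    (c : 'I_k -> R) (L : 'I_k -> V -> R) :
  (forall i, continuous (L i)) -> continuous (fun h => \sum_i c i * L i h).
Proof.
move=> Lc x; apply: cvg_big => [|i _]; first exact: add_continuous.
by apply: cvgM; [exact: cvg_cst|exact: Lc].
Qed.

(** Reduces class C^1 to a first-order estimate: the differential is a combination of finitely many
    fixed functionals of norm at most 1, so continuity of its coefficients gives continuity in
    operator norm. *)
Lemma C1_on_gradient (R : realType) (V : normedModType R) (k : nat)
    (l : 'I_k -> V -> R) (g : V -> R) (p : 'I_k -> V -> R) :
  (forall i, linear (l i)) -> (forall i h, `|l i h| <= `|h|) ->
  (forall i, continuous (p i)) ->
  (forall y (e : R), 0 < e -> \forall z \near y,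
     `|g z - g y - \sum_i p i y * l i (z - y)| <= e * `|z - y|) ->
  C1_on setT g /\ forall y h, 'd g y h = \sum_i p i y * l i h.
Proof.
move=> llin lle pc gp.
have lc i : continuous (l i).
  move=> x; apply/cvgrPdist_le => d d0; apply/near_normP; exists d => // y yx.
  have -> : l i x - l i y = l i (x - y).
    by have := llin i (-1) y x; rewrite !scaleN1r [- y + x]addrC [- l i y + _]addrC.
  by rewrite (le_trans (lle _ _))// distrC ltW.
have dg y : is_diff y g (fun h => \sum_i p i y * l i h).
  apply: is_diff_approx; last exact: gp.
  - move=> c u v; rewrite /GRing.scale/= mulr_sumr -big_split/=.
    by apply: eq_bigr => i _; rewrite llin /GRing.scale/=; ring.
  - exact: continuous_lincomb.
have dgE y h : 'd g y h = \sum_i p i y * l i h.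
  by have := dg y => ?; rewrite diff_val.
split=> //; split; [exact: openT|by move=> y _; exact: ex_diff|].
move=> y _ e e0.
(* The [k] coefficients share [e]; [k.+1] avoids a division by zero when [k = 0]. *)
pose c := e / k.+1%:R.
have c0 : 0 < c by rewrite divr_gt0.
have : \forall z \near y, forall i, `|p i z - p i y| <= c.
  apply: filter_forall => i.
  have /cvgrPdist_le := pc i y => /(_ _ c0).
  by apply: filterS => z; rewrite distrC.
apply: filterS => z pz h; rewrite !dgE -sumrB.
rewrite (le_trans (ler_norm_sum _ _ _))//.
rewrite (@le_trans _ _ (\sum_(i < k) c * `|h|))//.
  by apply: ler_sum => i _; rewrite -mulrBl normrM ler_pM.
rewrite sumr_const card_ord -mulr_natl mulrA ler_wpM2r//.
by rewrite /c mulrCA ler_piMr ?(ltW e0)// ler_pdivrMr// mul1r ler_nat.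
Qed.

(* [f - \sum_i c_i G_i] has zero differential at [Psi z], and along [Psi] each
   [G_i] grows like [L_i]. *)
Lemma diff_straightened (R : realType) (E : normedModType R) (k : nat)
    (G : 'I_k -> E -> R) (f : E -> R) (c : 'I_k -> R) (L : 'I_k -> E -> R)
    (Psi : E -> E) (z : E) :
  (forall i, differentiable (G i) (Psi z)) -> differentiable f (Psi z) ->
  (forall h, 'd f (Psi z) h = \sum_i c i * 'd (G i) (Psi z) h) ->
  (\forall w \near z, `|Psi w - Psi z| <= 2 * `|w - z|) ->
  (\forall w \near z, forall i, G i (Psi w) - G i (Psi z) = L i (w - z)) ->
  forall e : R, 0 < e -> \forall w \near z,
    `|f (Psi w) - f (Psi z) - \sum_i c i * L i (w - z)| <= e * `|w - z|.
Proof.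
move=> Gd fd fG Psil GL e e0.
(* In [S], the 1 accounts for the error of [f] and each [|c i|] for that of [G i]. The factor 2 in
   [e1] absorbs the Lipschitz constant of [Psi]. *)
pose S := 1 + \sum_i `|c i|.
have S0 : 0 < S by rewrite ltr_pwDl// sumr_ge0.
pose e1 := e / (2 * S).
have e10 : 0 < e1 by rewrite divr_gt0// mulr_gt0.
have Psic : Psi @ z --> Psi z.
  apply/cvgrPdist_le => d d0.
  have : \forall w \near z, `|w - z| < d / 2.
    by apply/near_normP; exists (d / 2) => //; rewrite divr_gt0.
  by move: Psil; apply: filterS2 => w h1 h2; rewrite distrC; lra.
have : \forall x \near Psi z,
    `|f x - f (Psi z) - 'd f (Psi z) (x - Psi z)| <= e1 * `|x - Psi z| /\
    forall i, `|G i x - G i (Psi z) - 'd (G i) (Psi z) (x - Psi z)|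
              <= e1 * `|x - Psi z|.
  apply: filterI; first exact: diff_approx.
  by apply: filter_forall => i; exact: diff_approx.
move=> /Psic; move: Psil GL; apply: filterS3 => w wz GLw [fw Gw].
pose x := Psi w; pose x1 := Psi z.
have -> : f x - f x1 - \sum_i c i * L i (w - z) =
    (f x - f x1 - 'd f x1 (x - x1)) -
    \sum_i c i * (G i x - G i x1 - 'd (G i) x1 (x - x1)).
  rewrite fG; under [X in _ = _ - X]eq_bigr do rewrite mulrBr GLw.
  by rewrite sumrB; ring.
rewrite (le_trans (ler_normB _ _))//.
apply: (@le_trans _ _ (e1 * S * `|x - x1|)); last first.
  have -> : e1 * S = e / 2 by rewrite /e1; field; rewrite gt_eqF.
  by rewrite -mulrA ler_pM2l// mulrC ler_pdivrMr// mulrC.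
rewrite /S mulrDr mulr1 mulrDl lerD// mulr_sumr mulr_suml.
rewrite (le_trans (ler_norm_sum _ _ _))// ler_sum// => i _.
by rewrite normrM -mulrA mulrCA ler_wpM2l.
Qed.

(** The function is [g = f \o Psi \o tau], where [tau] lifts values of [G] affinely along the dual
    vectors. Truncating its coordinates keeps [tau y] in the ball where [Psi] is controlled, for
    every [y]. *)
Lemma constant_rank_factorization (R : realType) (E : completeNormedModType R)
    (k : nat) (G : 'I_k -> E -> R) (f : E -> R) (x0 : E) (e : 'I_k -> E)
    (a : 'I_k -> E -> R) :
  (forall i, \forall x \near x0, differentiable (G i) x) ->
  (forall i (eta : R), 0 < eta ->
     \forall x \near x0, forall h, `|'d (G i) x h - 'd (G i) x0 h| <= eta * `|h|) ->
  (forall i j, 'd (G i) x0 (e j) = (i == j)%:R) ->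
  (\forall x \near x0, differentiable f x) ->
  (\forall x \near x0, forall h, 'd f x h = \sum_i a i x * 'd (G i) x h) ->
  (\forall x \near x0, forall i, {for x, continuous (a i)}) ->
  exists g : 'rV[R]_k -> R,
    C1_on setT g /\ \forall x \near x0, f x = g (\row_i G i x).
Proof.
move=> Gd Gc dual fd fG ac.
pose W x := (forall i, differentiable (G i) x) /\ [/\ differentiable f x,
  forall h, 'd f x h = \sum_i a i x * 'd (G i) x h &
  forall i, {for x, continuous (a i)}].
have W0 : nbhs x0 W.
  apply: filterI; first exact: filter_forall.
  by move: fd fG ac; apply: filterS3.
have [r [Psi [r0 PsiW Psil Psisurj]]] := @straightening R E k G x0 e W Gd Gc dual W0.
pose L i h := 'd (G i) x0 h.
have Llin i : linear (L i) by move=> c u v; rewrite /L linearP.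
have Lc i : continuous (L i).
  by apply: diff_continuous; exact: (nbhs_singleton (Gd i)).
have ballnear z : `|z - x0| < r -> \forall w \near z, `|w - x0| < r.
  move=> zr; apply/near_normP; exists (r - `|z - x0|); first by rewrite subr_gt0.
  move=> w wz; have := ler_normD (w - z) (z - x0); rewrite addrA subrK; lra.
have Psinear z : `|z - x0| < r -> \forall w \near z, `|Psi w - Psi z| <= 2 * `|w - z|.
  by move=> zr; apply: filterS (ballnear _ zr) => w wr; exact: Psil.
have Psic z : `|z - x0| < r -> {for z, continuous Psi}.
  move=> zr; apply/cvgrPdist_le => d d0.
  have wz : \forall w \near z, `|w - z| < d / 2.
    by apply/near_normP; exists (d / 2) => //; rewrite divr_gt0.
  by move: (Psinear _ zr) wz; apply: filterS2 => w h1 h2; rewrite distrC; lra.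
have Fest z : `|z - x0| < r -> forall d : R, 0 < d -> \forall w \near z,
    `|f (Psi w) - f (Psi z) - \sum_i a i (Psi z) * L i (w - z)| <= d * `|w - z|.
  move=> zr; have [[PG [Pf PfG _]] PL] := PsiW _ zr.
  apply: (@diff_straightened R E k G f (fun i => a i (Psi z)) L Psi z) => //.
    exact: Psinear.
  apply: filterS (ballnear _ zr) => w wr i; rewrite (PsiW _ wr).2 PL /L.
  by rewrite !linearB/=; ring.
have Fdiff z : `|z - x0| < r -> is_diff z (f \o Psi)
    (fun h => \sum_i a i (Psi z) * L i h).
  move=> zr; apply: is_diff_approx; last exact: Fest.
    move=> c u v; rewrite /GRing.scale/= mulr_sumr -big_split/=.
    by apply: eq_bigr => i _; rewrite Llin /GRing.scale/=; ring.
  exact: continuous_lincomb.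
pose S := 1 + \sum_j `|e j|.
have S0 : 0 < S by rewrite ltr_pwDl// sumr_ge0.
(* The truncated coordinates are at most [2 * d], so [tau] stays within [2 * d * S = r / 2] of
   [x0]. *)
pose d := r / (4 * S).
have d0 : 0 < d by rewrite divr_gt0// mulr_gt0.
have [s [s' [sid sle s'c sest]]] := C1_truncation d0.
pose t j (y : 'rV[R]_k) := s (y 0 j - G j x0).
pose tau (y : 'rV[R]_k) := x0 + \sum_j t j y *: e j.
have taur y : `|tau y - x0| < r.
  rewrite /tau addrAC subrr add0r (le_lt_trans (ler_norm_sum _ _ _))//.
  apply: (@le_lt_trans _ _ (\sum_j 2 * d * `|e j|)).
    by apply: ler_sum => j _; rewrite normrZ ler_wpM2r// /t sle.
  rewrite -mulr_sumr (@lt_le_trans _ _ (2 * d * S))//.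
    have dd0 : 0 < 2 * d by rewrite mulr_gt0.
    by rewrite (ltr_pM2l dd0) /S ltrDr.
  have -> : 2 * d * S = r / 2 by rewrite /d; field; rewrite gt_eqF.
  by rewrite ler_pdivrMr//; lra.
have Ltau i y z : L i (tau z - tau y) = t i z - t i y.
  have -> : tau z - tau y = \sum_j (t j z - t j y) *: e j.
    rewrite /tau opprD addrACA subrr add0r -sumrB.
    by apply: eq_bigr => j _; rewrite scalerBl.
  rewrite /L linear_sum (bigD1 i)//= big1 => [|j ji].
    by rewrite linearZ/= dual eqxx /GRing.scale/= mulr1 addr0.
  by rewrite linearZ/= dual eq_sym (negbTE ji) scaler0.
have test i y z : `|t i z - t i y - s' (y 0 i - G i x0) * (z 0 i - y 0 i)|
    <= d^-1 * `|z - y| ^+ 2.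
  have -> : z 0 i - y 0 i = (z 0 i - G i x0) - (y 0 i - G i x0).
    by rewrite opprB addrA subrK.
  rewrite (le_trans (sest _ _))// ler_pM2l ?invr_gt0//.
  rewrite -[leLHS]real_normK ?num_real// lerXn2r ?nnegrE//.
  have -> : z 0 i - G i x0 - (y 0 i - G i x0) = (z - y) 0 i.
    by rewrite !mxE opprB addrA subrK.
  exact: ler_coord_norm.
(* A Lipschitz constant of [tau] at [y], valid for [|z - y| < d]: there the quadratic remainder of
   [s] is at most [|z - y|], which gives the 1 added to [|s'|]. *)
pose K (y : 'rV[R]_k) := 1 + \sum_j (1 + `|s' (y 0 j - G j x0)|) * `|e j|.
have K0 y : 0 < K y.
  by rewrite ltr_pwDl// sumr_ge0// => j _; rewrite mulr_ge0// addr_ge0.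
have taul y : \forall z \near y, `|tau z - tau y| <= K y * `|z - y|.
  apply/near_normP; exists d => // z zd.
  have -> : tau z - tau y = \sum_j (t j z - t j y) *: e j.
    rewrite /tau opprD addrACA subrr add0r -sumrB.
    by apply: eq_bigr => j _; rewrite scalerBl.
  rewrite (le_trans (ler_norm_sum _ _ _))//.
  rewrite /K mulrDl mul1r ler_wpDl// mulr_suml.
  apply: ler_sum => j _; rewrite normrZ mulrAC ler_wpM2r//.
  have h1 := test j y z.
  have h2 : d^-1 * `|z - y| ^+ 2 <= `|z - y|.
    by rewrite expr2 mulrA ler_piMl// ler_pdivrMl// mulr1 ltW.
  have h3 : `|s' (y 0 j - G j x0) * (z 0 j - y 0 j)|
      <= `|s' (y 0 j - G j x0)| * `|z - y|.
    rewrite normrM ler_wpM2l//.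
    by have := ler_coord_norm (z - y) 0 j; rewrite !mxE.
  have := ler_normD (t j z - t j y - s' (y 0 j - G j x0) * (z 0 j - y 0 j))
    (s' (y 0 j - G j x0) * (z 0 j - y 0 j)).
  rewrite subrK; lra.
have tauc (y : 'rV[R]_k) : {for y, continuous tau}.
  apply/(@cvgrPdist_le _ _ _ _ (nbhs_filter y)) => eps eps0.
  have zy : \forall z \near y, `|z - y| < eps / K y.
    by apply/near_normP; exists (eps / K y) => //; rewrite divr_gt0.
  apply: filterS2 (taul y) zy => z h1 h2; rewrite distrC.
  by rewrite (le_trans h1)// mulrC -ler_pdivlMr// ltW.
pose g (y : 'rV[R]_k) := f (Psi (tau y)).
(* The partial derivatives of [g] predicted by the chain rule, since [L i] sees only the [i]-th
   coordinate of [tau]. *)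
pose p i (y : 'rV[R]_k) := a i (Psi (tau y)) * s' (y 0 i - G i x0).
have [gC1 _] : C1_on setT g /\ forall y h, 'd g y h = \sum_i p i y * h 0 i.
  apply: (@C1_on_gradient R 'rV[R]_k k (fun i h => h 0 i)).
  - by move=> i c u v; rewrite !mxE.
  - by move=> i h; exact: ler_coord_norm.
  - move=> i y; apply: continuousM.
      apply: (@continuous_comp _ _ _ (Psi \o tau) (a i)).
        by apply: continuous_comp; [exact: tauc|exact: Psic].
      by have [[_ [_ _ aPsi]] _] := PsiW _ (taur y); exact: aPsi.
    apply: (@continuous_comp _ _ _ (fun y : 'rV[R]_k => y 0 i - G i x0) s').
      by apply: continuousB; [exact: coord_continuous|exact: cst_continuous].
    exact: s'c.
  move=> y eps eps0.
  pose A := 1 + \sum_i `|a i (Psi (tau y))|.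
  have A0 : 0 < A by rewrite ltr_pwDl// sumr_ge0.
  have eK0 : 0 < eps / (2 * K y) by rewrite divr_gt0// mulr_gt0.
  have h1 : \forall z \near y, `|f (Psi (tau z)) - f (Psi (tau y)) -
      \sum_i a i (Psi (tau y)) * L i (tau z - tau y)|
      <= eps / (2 * K y) * `|tau z - tau y|.
    exact: (tauc y _ (Fest _ (taur y) _ eK0)).
  have h2 : \forall z \near y, `|z - y| < eps * d / (2 * A).
    apply/near_normP; exists (eps * d / (2 * A)) => //.
    by rewrite !(divr_gt0, mulr_gt0).
  apply: filterS3 h1 h2 (taul y) => z h1 h2 h3.
  rewrite /g.
  set X := f _ - f _.
  (* The error splits into that of [f \o Psi] at [tau y] and that of linearizing the truncation;
     each receives [eps / 2]. *)
  have -> : X - \sum_i p i y * (z - y) 0 i =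
    (X - \sum_i a i (Psi (tau y)) * L i (tau z - tau y)) +
    \sum_i a i (Psi (tau y)) * (t i z - t i y - s' (y 0 i - G i x0) * (z 0 i - y 0 i)).
    have -> : \sum_i p i y * (z - y) 0 i =
      \sum_i a i (Psi (tau y)) * L i (tau z - tau y) -
      \sum_i a i (Psi (tau y)) * (t i z - t i y - s' (y 0 i - G i x0) * (z 0 i - y 0 i)).
      by rewrite -sumrB; apply: eq_bigr => i _; rewrite Ltau /p !mxE; ring.
    by rewrite opprB addrA addrAC.
  rewrite (le_trans (ler_normD _ _))//.
  have -> : eps * `|z - y| = eps / 2 * `|z - y| + eps / 2 * `|z - y| by field.
  rewrite lerD//.
    rewrite (le_trans h1)//.
    have -> : eps / 2 * `|z - y| = eps / (2 * K y) * (K y * `|z - y|).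
      by field; rewrite gt_eqF.
    by rewrite ler_wpM2l// ltW.
  rewrite (le_trans (ler_norm_sum _ _ _))//.
  apply: (@le_trans _ _ (\sum_i `|a i (Psi (tau y))| * (d^-1 * `|z - y| ^+ 2))).
    by apply: ler_sum => i _; rewrite normrM ler_wpM2l.
  rewrite -mulr_suml expr2 !mulrA ler_wpM2r//.
  apply: (@le_trans _ _ (A / d * (eps * d / (2 * A)))).
    apply: ler_pM; rewrite ?(ltW h2)//.
      by rewrite divr_ge0 ?sumr_ge0// ltW.
    by rewrite ler_wpM2r ?invr_ge0 ?(ltW d0)// /A lerDr.
  by rewrite le_eqVlt; apply/orP; left; apply/eqP; field; rewrite !gt_eqF.
exists g; split=> //.
(* For such [x] the truncation acts as the identity on the coordinates of [G x - G x0]. *)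
have Gnear : \forall x \near x0, forall j, `|G j x - G j x0| <= d.
  apply: filter_forall => j.
  have /cvgrPdist_le := differentiable_continuous (nbhs_singleton (Gd j)) => /(_ _ d0).
  by apply: filterS => x; rewrite distrC.
move: Psisurj Gnear; apply: filterS2 => x [z zr Pz] Gx.
have tj j : t j (\row_i G i x) = L j (z - x0).
  rewrite /t mxE sid// -Pz (PsiW _ zr).2; by rewrite addrAC subrr add0r.
set y := \row_i G i x in tj *.
(* [z] and [tau y] have the same image under every [L i], so the derivative of [f \o Psi] vanishes
   in the direction [z - tau y] at each point of the segment, and [f \o Psi] takes equal values at
   its ends. *)
have [|th th01] := @mean_value_segment _ _ (f \o Psi) (tau y) (z - tau y).
  move=> th th01; have zth := normB_segment_lt zr (taur y) th01.
  by have := Fdiff _ zth => ?; exact: ex_diff.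
have zth := normB_segment_lt zr (taur y) th01.
have := Fdiff _ zth => Fz; rewrite diff_val big1; last first.
  move=> i _; apply/eqP; rewrite mulf_eq0; apply/orP; right; apply/eqP.
  have -> : z - tau y = (z - x0) - \sum_j t j y *: e j.
    by rewrite /tau opprD addrA.
  rewrite /L linearB/= linear_sum (bigD1 i)//= big1 => [|j ji].
    by rewrite linearZ/= dual eqxx /GRing.scale/= mulr1 addr0 tj subrr.
  by rewrite linearZ/= dual eq_sym (negbTE ji) scaler0.
by rewrite /g /= subrKC Pz => /subr0_eq.
Qed.

(** * Linear algebra: dual vectors and rank *)

(** [V] may be infinite-dimensional, so the functionals are sampled on finitely many vectors, chosen
    to maximize the rank of the matrix of values. Independence forces full column rank, and a left
    inverse of the matrix combines the samples into dual vectors. *)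
Lemma dual_vectors (R : realType) (V : lmodType R) (k : nat)
    (L : 'I_k -> V -> R) :
  (forall i, linear (L i)) -> lin_indep L ->
  exists e : 'I_k -> V, forall i j, L i (e j) = (i == j)%:R.
Proof.
move=> Llin Lind.
pose mxL m (e : 'I_m -> V) := \matrix_(a < m, j < k) L j (e a).
pose P r := `[< exists m (e : 'I_m -> V), \rank (mxL m e) = r >].
have P0 : exists r, P r.
  by exists (\rank (mxL 0 (fun _ => 0))); apply/asboolP; exists 0%N, (fun _ => 0).
have Pk r : P r -> (r <= k)%N by move=> /asboolP[m [e <-]]; exact: rank_leq_col.
case: (ex_maxnP P0 Pk) => r /asboolP[m [e er]] rmax.
(* Appending the sample [v] cannot raise the maximal rank, so its row already lies in the row
   space. *)
have sub v : (\row_j L j v <= mxL m e)%MS.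
  pose e' (a : 'I_(m + 1)) := if fintype.split a is inl a' then e a' else v.
  have e'E : mxL (m + 1)%N e' = col_mx (mxL m e) (\row_j L j v).
    by apply/matrixP => a j; rewrite !mxE /e'; case: fintype.split => b; rewrite mxE.
  have : (\rank (mxL (m + 1)%N e') <= r)%N.
    by apply: rmax; apply/asboolP; exists (m + 1)%N, e'.
  have sM : (mxL m e <= mxL (m + 1)%N e')%MS by rewrite e'E -addsmxE addsmxSl.
  rewrite -er (geq_leqif (mxrank_leqif_sup sM)) => /(submx_trans _); apply.
  by rewrite e'E -addsmxE addsmxSr.
(* A column of the cokernel kills all rows, hence is a linear relation between the [L j] on the
   whole of [V]. *)
have full : row_full (mxL m e).
  rewrite -cokermx_eq0; apply/eqP/matrixP => j b; rewrite [RHS]mxE.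
  apply: (Lind (fun j => cokermx (mxL m e) j b)).
  apply/funext => v; rewrite fct_sumE.
  have := sub v; rewrite submxE => /eqP/matrixP/(_ 0 b).
  rewrite mxE [in X in _ = X -> _]mxE => vb.
  by apply: (etrans _ vb); apply: eq_bigr => i _; rewrite [X in X * _]mxE mulrC.
have /row_fullP[D DM] := full.
exists (fun j => \sum_a D j a *: e a) => i j.
pose Li : {linear V -> R^o} :=
  HB.pack (L i) (GRing.isLinear.Build _ _ _ _ (L i) (Llin i)).
rewrite -[L i]/(Li : _ -> _) linear_sum eq_sym.
have -> : (j == i)%:R = (1%:M : 'M[R]_k) j i by rewrite mxE.
by rewrite -DM mxE; apply: eq_bigr => a _; rewrite linearZ mxE.
Qed.

Lemma lin_indep_setP (R : realType) (V : lmodType R) (I : finType)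
    (v : I -> V) (J : {set I}) :
  lin_indep (fun j : {i | i \in J} => v (val j)) <->
  forall c : I -> R, \sum_(i in J) c i *: v i = 0 -> forall i, i \in J -> c i = 0.
Proof.
split=> [ind c c0 i iJ|ind c c0 u].
  apply: (ind (fun j => c (val j)) _ (exist _ i iJ)).
  by rewrite -(big_sub _ (fun i => c i *: v i)).
pose c' i := if insub i is Some u then c u else 0.
have c'E (w : {i | i \in J}) : c' (val w) = c w by rewrite /c' valK.
rewrite -c'E; apply: ind; last exact: (valP u).
rewrite (big_sub _ (fun i => c' i *: v i)) -[RHS]c0.
by apply: eq_bigr => w _; rewrite c'E.
Qed.

(** Adding an outside index [i] to [J] creates a relation; its coefficient at [i] is nonzero because
    [J] is independent, so the relation can be solved for [v i]. *)
Lemma maxset_lin_indep_span (R : realType) (V : lmodType R) (I : finType)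
    (v : I -> V) (J : {set I}) :
  maxset (fun J => `[< lin_indep (fun j : {i | i \in J} => v (val j)) >]) J ->
  forall i, exists d : I -> R, v i = \sum_(j in J) d j *: v j.
Proof.
move=> /maxsetP[/asboolP/lin_indep_setP Jind Jmax] i.
have [iJ|iJ] := boolP (i \in J).
  exists (fun j => (j == i)%:R); rewrite (bigD1 i)//= eqxx scale1r big1 ?addr0//.
  by move=> j /andP[_ /negbTE ->]; rewrite scale0r.
have : ~ lin_indep (fun j : {j | j \in i |: J} => v (val j)).
  move=> /asboolP/Jmax/(_ (finset.subsetUr _ _)) JE.
  by move: iJ; rewrite -JE setU11.
move=> /lin_indep_setP/existsNP[c /not_implyP[]].
rewrite big_setU1//= => c0 /existsNP[j /not_implyP[jJ cj]].
have ci : c i != 0.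
  apply/eqP => ci0; move: c0; rewrite ci0 scale0r add0r => /Jind cJ.
  by move: jJ; rewrite !inE => /orP[/eqP ji|/cJ//]; apply: cj; rewrite ji.
exists (fun j => - (c i)^-1 * c j).
under eq_bigr do rewrite -scalerA.
rewrite -scaler_sumr; move: c0 => /eqP; rewrite addrC addr_eq0 => /eqP ->.
by rewrite scalerN scaleNr opprK scalerA mulVf// scale1r.
Qed.

Lemma has_rank_dependent (R : realType) (V : lmodType R) (I : finType)
    (v : I -> V) (r : nat) (w : 'I_r.+1 -> I) :
  has_rank v r -> ~ lin_indep (v \o w).
Proof.
move=> [J /maxset_lin_indep_span span Jr] ind.
have [d dE] := choice span.
(* Coordinates of the [r.+1] vectors over the [r] spanning ones: more rows than columns, so the left
   kernel is nonzero. *)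
pose D := \matrix_(a < r.+1, b < #|J|) d (w a) (enum_val b).
have : kermx D != 0.
  by rewrite kermx_eq0 -row_leq_rank -ltnNge ltnS (leq_trans (rank_leq_col _))// Jr.
move=> /rowV0Pn[c /sub_kermxP cD c0].
move/eqP: c0; apply; apply/rowP => a; rewrite [RHS]mxE.
apply: (ind (fun a => c 0 a)) => /=.
under eq_bigr do rewrite dE scaler_sumr.
rewrite exchange_big big1//= => j jJ.
under eq_bigr do rewrite scalerA.
rewrite -scaler_suml.
have /matrixP/(_ 0 (enum_rank_in jJ j)) := cD; rewrite !mxE.
under eq_bigr do rewrite mxE enum_rankK_in//.
by move=> ->; rewrite scale0r.
Qed.

(** * Continuity of the coefficients *)

(** Near [x0] the matrix of the [DG_i(x) (e_j)] is close to the identity, so its inverse is bounded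
    by 2. The bound gives both independence of the [DG_i(x)] near [x0] and continuity of the
    coefficients [a_i]. *)
Lemma near_dual_coef_bound (R : realType) (E : normedModType R) (k : nat)
    (G : 'I_k -> E -> R) (x0 : E) (e : 'I_k -> E) :
  (forall i (eta : R), 0 < eta ->
     \forall x \near x0, forall h, `|'d (G i) x h - 'd (G i) x0 h| <= eta * `|h|) ->
  (forall i j, 'd (G i) x0 (e j) = (i == j)%:R) ->
  \forall x \near x0, forall c : 'I_k -> R,
    \sum_j `|c j| <= 2 * \sum_j `|\sum_i c i * 'd (G i) x (e j)|.
Proof.
move=> Gc dual.
pose S := 1 + \sum_j `|e j|.
have S0 : 0 < S by rewrite ltr_pwDl// sumr_ge0.
pose eta := (2 * S)^-1.
have eta0 : 0 < eta by rewrite invr_gt0 mulr_gt0.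
have : \forall x \near x0, forall i h,
    `|'d (G i) x h - 'd (G i) x0 h| <= eta * `|h|.
  by apply: filter_forall => i; exact: Gc.
apply: filterS => x Gx c.
pose N := \sum_j `|c j|.
have N0 : 0 <= N by rewrite sumr_ge0.
have cj j : `|c j| <= `|\sum_i c i * 'd (G i) x (e j)| + N * (eta * `|e j|).
  have -> : c j = \sum_i c i * 'd (G i) x (e j) -
      \sum_i c i * ('d (G i) x (e j) - 'd (G i) x0 (e j)).
    rewrite -sumrB (bigD1 j)//= big1 => [|i ij].
      by rewrite dual eqxx mulr1n; ring.
    by rewrite dual (negbTE ij) mulr0n; ring.
  rewrite (le_trans (ler_normB _ _))// lerD2l (le_trans (ler_norm_sum _ _ _))//.
  by rewrite mulr_suml ler_sum// => i _; rewrite normrM ler_wpM2l.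
(* Summing the deviations costs at most half of [N], which the left-hand side absorbs. *)
have : N <= \sum_j `|\sum_i c i * 'd (G i) x (e j)| + N / 2.
  rewrite (le_trans (ler_sum _ (fun j _ => cj j)))// big_split/= lerD2l.
  rewrite -mulr_sumr ler_wpM2l// -mulr_sumr.
  have -> : 2^-1 = eta * S by rewrite /eta; field; rewrite gt_eqF.
  by rewrite ler_wpM2l ?(ltW eta0)// lerDr.
rewrite -/N; lra.
Qed.

(** Class C^1 phrased as a property of all points near [x0], so that it combines with other local
    conditions by filter reasoning. *)
Definition C1_around (R : realType) (E : normedModType R) (f : E -> R) (x0 : E) :=
  \forall x \near x0, differentiable f x /\ forall e : R, 0 < e ->
    \forall y \near x, forall h : E, `|'d f y h - 'd f x h| <= e * `|h|.

Lemma C1_near_around (R : realType) (E : normedModType R) (U : set E)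
    (f : E -> R) (x0 : E) : C1_near U f x0 -> C1_around f x0.
Proof.
move=> [A [Ax0 _ [Aop fd fc]]]; apply: filterS (open_nbhs_nbhs (conj Aop Ax0)).
by move=> x Ax; split; [exact: fd|exact: fc].
Qed.

(** Subtracting the relations at [y] and [x] expresses the combination of the [DG_i(y)] with
    coefficients [a_i(y) - a_i(x)] through increments of [Df] and [DG_i], which are small; the
    coefficient bound then applies at [y]. *)
Lemma near_coefficients_continuous (R : realType) (E : normedModType R) (k : nat)
    (G : 'I_k -> E -> R) (f : E -> R) (x0 : E) (e : 'I_k -> E)
    (a : 'I_k -> E -> R) :
  (forall i, C1_around (G i) x0) -> C1_around f x0 ->
  (forall i j, 'd (G i) x0 (e j) = (i == j)%:R) ->
  (\forall x \near x0, forall h, 'd f x h = \sum_i a i x * 'd (G i) x h) ->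
  \forall x \near x0, forall i, {for x, continuous (a i)}.
Proof.
move=> G1 f1 dual fG.
have Gb := near_dual_coef_bound (fun i => (nbhs_singleton (G1 i)).2) dual.
have G1' : \forall x \near x0, forall i, differentiable (G i) x /\
    forall eta : R, 0 < eta ->
      \forall y \near x, forall h, `|'d (G i) y h - 'd (G i) x h| <= eta * `|h|.
  exact: filter_forall.
have : \forall x \near x0, (forall h, 'd f x h = \sum_i a i x * 'd (G i) x h) /\
   forall c : 'I_k -> R,
    \sum_j `|c j| <= 2 * \sum_j `|\sum_i c i * 'd (G i) x (e j)|.
  exact: filterI.
(* The interior is taken since the relation and the bound are used at all [y] near [x]. *)
move=> /nbhs_interior near_W; apply: filterS3 f1 G1' near_W => x [_ fx] Gx near_x i.
have [fGx _] := nbhs_singleton near_x.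
apply/cvgrPdist_le => eps eps0.
pose A := 1 + \sum_i `|a i x|.
have A0 : 0 < A by rewrite ltr_pwDl// sumr_ge0.
pose S := 1 + \sum_j `|e j|.
have S0 : 0 < S by rewrite ltr_pwDl// sumr_ge0.
pose eta := eps / (2 * A * S).
have eta0 : 0 < eta by rewrite divr_gt0// !mulr_gt0.
have : \forall y \near x, forall i h, `|'d (G i) y h - 'd (G i) x h| <= eta * `|h|.
  by apply: filter_forall => j; exact: (Gx j).2.
move: near_x (fx _ eta0); apply: filterS3 => y [fGy yb] fyx Gyx.
have key h : `|\sum_i (a i y - a i x) * 'd (G i) y h| <= A * eta * `|h|.
  have -> : \sum_i (a i y - a i x) * 'd (G i) y h = ('d f y h - 'd f x h) -
      \sum_i a i x * ('d (G i) y h - 'd (G i) x h).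
    rewrite fGx fGy -!sumrB; apply: eq_bigr => j _; ring.
  rewrite (le_trans (ler_normB _ _))// /A !mulrDl mul1r lerD//.
  rewrite (le_trans (ler_norm_sum _ _ _))// -mulrA mulr_suml.
  by rewrite ler_sum// => j _; rewrite normrM ler_wpM2l.
rewrite distrC (@le_trans _ _ (\sum_j `|a j y - a j x|))//.
  by rewrite (bigD1 i)//= lerDl sumr_ge0.
rewrite (le_trans (yb _))//.
rewrite (@le_trans _ _ (2 * (A * eta * S)))//.
  rewrite ler_pM2l// (le_trans (ler_sum _ (fun j _ => key (e j))))//.
  by rewrite -mulr_sumr ler_wpM2l ?lerDr// ltW// mulr_gt0.
by rewrite le_eqVlt; apply/orP; left; apply/eqP; rewrite /eta; field; rewrite !gt_eqF.
Qed.

(** * Criteria for functional dependence and independence *)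

(** Serves for the defining function of a graph, with [l] the last coordinate and [w] the projection
    onto the others. *)
Lemma C1_on_sub_comp (R : realType) (V W : normedModType R) (l : V -> R)
    (w : V -> W) (g : W -> R) :
  linear l -> (forall h, `|l h| <= `|h|) ->
  linear w -> (forall h, `|w h| <= `|h|) -> C1_on setT g ->
  C1_on setT (fun v => l v - g (w v)) /\
  forall v h, 'd (fun v => l v - g (w v)) v h = l h - 'd g (w v) (w h).
Proof.
move=> llin ll wlin wl [_ gd gc].
pose L : {linear V -> R^o} := HB.pack l (GRing.isLinear.Build _ _ _ _ l llin).
pose W' : {linear V -> W} := HB.pack w (GRing.isLinear.Build _ _ _ _ w wlin).
have wB u v : w u - w v = w (u - v) by rewrite -[w]/(W' : _ -> _) linearB.
have lB u v : l u - l v = l (u - v) by rewrite -[l]/(L : _ -> _) linearB.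
have wc : continuous w.
  move=> x; apply/cvgrPdist_le => d d0; apply/near_normP; exists d => // y yx.
  by rewrite wB (le_trans (wl _))// distrC ltW.
have lc : continuous l.
  move=> x; apply/cvgrPdist_le => d d0; apply/near_normP; exists d => // y yx.
  by rewrite lB (le_trans (ll _))// distrC ltW.
have Fd v : is_diff v (fun v => l v - g (w v)) (fun h => l h - 'd g (w v) (w h)).
  apply: is_diff_approx.
  - move=> c u z; rewrite llin wlin linearP.
    rewrite -[X in _ - (X + _)]/(c * _) /GRing.scale/=; ring.
  - move=> x; apply: cvgB; first exact: lc.
    apply: (@continuous_comp _ _ _ w ('d g (w v))); first exact: wc.
    by apply: diff_continuous; exact: gd.
  - move=> e e0.
    have : \forall z \near v,
        `|g (w z) - g (w v) - 'd g (w v) (w z - w v)| <= e * `|w z - w v|.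
      exact: (wc v _ (diff_approx (gd (w v) I) e0)).
    apply: filterS => z zv.
    rewrite -lB -wB; set X := 'd g _ _ in zv *.
    have -> : l z - g (w z) - (l v - g (w v)) - (l z - l v - X) =
      - (g (w z) - g (w v) - X) by ring.
    by rewrite normrN (le_trans zv)// wB ler_wpM2l// ltW.
have FE v h : 'd (fun v => l v - g (w v)) v h = l h - 'd g (w v) (w h).
  by have := Fd v => ?; rewrite diff_val.
split=> //; split; [exact: openT|by move=> v _; exact: ex_diff|].
move=> v _ e e0.
have : \forall z \near v, forall h, `|'d g (w z) h - 'd g (w v) h| <= e * `|h|.
  exact: (wc v _ (gc (w v) I e e0)).
apply: filterS => z zv h; rewrite !FE.
have -> : l h - 'd g (w z) (w h) - (l h - 'd g (w v) (w h)) =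
  - ('d g (w z) (w h) - 'd g (w v) (w h)) by ring.
by rewrite normrN (le_trans (zv _))// ler_wpM2l// ltW.
Qed.

(** The differential of [F \o G] at [x] is the composite by the chain rule and zero by local
    vanishing; differentials are unique. *)
Lemma diff_comp_near0 (R : realType) (V W : normedModType R) (G J : V -> W)
    (F : W -> R) (x : V) :
  is_diff x G J -> differentiable F (G x) ->
  (\forall y \near x, F (G y) = 0) -> forall v, 'd F (G x) (J v) = 0.
Proof.
move=> Gd Fd F0 v.
have FG := differentiableP Fd.
have dFG : is_diff x (F \o G) ('d F (G x) \o J) by exact: is_diff_comp.
have d0 : is_diff x (F \o G) (fun=> 0).
  apply: is_diff_approx.
  - by move=> c u z; rewrite scaler0 addr0.
  - exact: cst_continuous.
  - move=> e e0; have F0x := nbhs_singleton F0.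
    apply: filterS F0 => y Fy /=.
    by rewrite Fy F0x !subr0 normr0 mulr_ge0// ltW.
have E1 := @diff_val _ _ _ _ _ _ _ dFG; have E0 := @diff_val _ _ _ _ _ _ _ d0.
by have := congr1 (fun u => u v) (etrans (esym E1) E0).
Qed.

Lemma mx_norm_le (R : realType) (m n : nat) (A : 'M[R]_(m, n)) (c : R) :
  0 <= c -> (forall i j, `|A i j| <= c) -> `|A| <= c.
Proof.
move=> c0 Ac; rewrite [leLHS]/Num.norm/= mx_normrE.
by apply/bigmax_leP; split=> // ij _; exact: Ac.
Qed.

Lemma is_diff_joint (R : realType) (E : normedModType R) (m : nat)
    (f : 'I_m -> E -> R) (x : E) : (forall a, differentiable (f a) x) ->
  is_diff x (joint f) (fun h => \row_a 'd (f a) x h).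
Proof.
move=> fd; apply: is_diff_approx.
- by move=> c u v; apply/rowP => a; rewrite !mxE linearP.
- move=> u; apply/cvgrPdist_le => e e0.
  have : \forall v \near u, forall a, `|'d (f a) x u - 'd (f a) x v| <= e.
    apply: filter_forall => a.
    have dc : {for u, continuous ('d (f a) x)} by exact: diff_continuous.
    by have /cvgrPdist_le := dc => /(_ _ e0).
  apply: filterS => v uv; apply: mx_norm_le => [|i a]; first exact: ltW.
  by rewrite !mxE.
- move=> e e0.
  have : \forall y \near x, forall a,
      `|f a y - f a x - 'd (f a) x (y - x)| <= e * `|y - x|.
    by apply: filter_forall => a; exact: diff_approx.
  apply: filterS => y xy; apply: mx_norm_le => [|i a].
    by rewrite mulr_ge0// ltW.
  by rewrite !mxE.
Qed.

Lemma dual_functionally_independent (R : realType) (E : normedModType R)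
    (U : set E) (m : nat) (f : 'I_m -> E -> R) (x0 : E) (e : 'I_m -> E) :
  (forall a, differentiable (f a) x0) ->
  (forall a b, 'd (f a) x0 (e b) = (a == b)%:R) ->
  functionally_independent U f x0.
Proof.
move=> fd dual [A [B [F [[A0 _] [By0 _] [_ Fd _] F0 dF]]]]; apply: dF.
have FJ := @diff_comp_near0 R E 'rV[R]_m _ _ F x0 (is_diff_joint fd) (Fd _ By0)
  (filterS F0 A0).
apply/funext => h; rewrite (row_sum_delta h) linear_sum big1// => b _.
rewrite linearZ/= (_ : delta_mx 0 b = \row_a 'd (f a) x0 (e b)).
  by rewrite FJ scaler0.
by apply/rowP => a; rewrite !mxE dual eqxx.
Qed.

Lemma graph_functionally_dependent (R : realType) (E : normedModType R)
    (U : set E) (x0 : E) (m k : nat) (f : 'I_m -> E -> R) (i : 'I_k -> 'I_m)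
    (l : 'I_m) (g : 'rV[R]_k -> R) :
  nbhs x0 U -> C1_on setT g ->
  (\forall x \near x0, f l x = g (joint (fun j => f (i j)) x)) ->
  functionally_dependent U (append_fun f i l) x0.
Proof.
move=> Ux0 gC1 fg.
pose w (v : 'rV[R]_k.+1) : 'rV[R]_k := \row_j v 0 (lift ord_max j).
pose c (v : 'rV[R]_k.+1) := v 0 ord_max.
have [||||FC1 dF] := @C1_on_sub_comp R 'rV[R]_k.+1 'rV[R]_k c w g _ _ _ _ gC1.
- by move=> r u v; rewrite /c !mxE.
- by move=> h; exact: ler_coord_norm.
- by move=> r u v; apply/rowP => j; rewrite !mxE.
- by move=> h; apply: mx_norm_le => // a j; rewrite mxE; exact: ler_coord_norm.
exists (U `&` [set x | f l x = g (joint (fun j => f (i j)) x)]), setT,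
  (fun v => c v - g (w v)); split=> //.
- by split; [exact: filterI|move=> x []].
- move=> x [_ /= fgx].
  have -> : w (joint (append_fun f i l) x) = joint (fun j => f (i j)) x.
    by apply/rowP => j; rewrite !mxE /append_fun liftK.
  by rewrite /c mxE /append_fun unlift_none fgx subrr.
(* The last basis vector is invisible to [g \o w], so the differential takes the value 1 on it. *)
- have wd : w (delta_mx 0 ord_max) = 0.
    by apply/rowP => j; rewrite !mxE eq_sym (negbTE (neq_lift _ _)) andbF.
  move=> /(congr1 (fun u => u (delta_mx 0 ord_max))).
  rewrite dF wd linear0 subr0 /c mxE !eqxx mulr1n => /eqP.
  by rewrite oner_eq0.
Qed.

(** * From constant rank to the two conclusions *)

Lemma constant_rank_span (R : realType) (E : normedModType R) (m k : nat)
    (f : 'I_m -> E -> R) (i : 'I_k -> 'I_m) (l : 'I_m) (x : E) :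
  has_rank (differentials f x) k ->
  lin_indep (fun j => differentials f x (i j)) ->
  exists c : 'I_k -> R, forall h, 'd (f l) x h = \sum_j c j * 'd (f (i j)) x h.
Proof.
move=> frank find.
pose w (a : 'I_k.+1) := if unlift ord_max a is Some j then i j else l.
have /existsNP[c /not_implyP[]] := has_rank_dependent (w := w) frank.
rewrite (bigD1_ord ord_max)//= {1}/w unlift_none => c0 /existsNP[a ca].
have c0h h : c ord_max * 'd (f l) x h +
    \sum_j c (lift ord_max j) * 'd (f (i j)) x h = 0.
  have := congr1 (fun u => u h) c0.
  rewrite /= fctE fct_sumE => ch; apply: (etrans _ ch); congr (_ + _).
  by apply: eq_bigr => j _; rewrite /w liftK.
(* A relation not involving [f l] would contradict the independence of the other differentials. *)
have cmax : c ord_max != 0.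
  apply/eqP => cm0; apply: ca.
  have cl j : c (lift ord_max j) = 0.
    apply: (find (fun j => c (lift ord_max j))).
    apply/funext => h; rewrite fct_sumE.
    by apply: (etrans _ (c0h h)); rewrite cm0 mul0r add0r.
  by case: (unliftP ord_max a) => [j|] ->.
exists (fun j => - (c ord_max)^-1 * c (lift ord_max j)) => h.
under eq_bigr do rewrite -mulrA.
rewrite -mulr_sumr; apply: (mulfI cmax).
rewrite mulrA mulrN mulfV// mulN1r; apply/eqP.
by rewrite -addr_eq0; apply/eqP.
Qed.

Theorem proposition4p2 (R : realType) (E : completeNormedModType R)
  (U : set E) (x0 : E) (kappa : nat) (f : 'I_kappa -> E -> R)
  (V : set E) (k : nat) (i : 'I_k -> 'I_kappa) :
  open U -> U x0 ->
  (forall j : 'I_kappa, C1_near U (f j) x0) ->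
  constant_rank U f x0 V k ->
  injective i ->
  lin_indep (fun j : 'I_k => differentials f x0 (i j)) ->
  (k = kappa -> functionally_independent U f x0) /\
  ((k < kappa)%N ->
   forall l : 'I_kappa, (forall j : 'I_k, l <> i j) ->
     functionally_dependent U (append_fun f i l) x0 /\
     exists g : 'rV[R]_k -> R,
       C1_on setT g /\
       \forall x \near x0, f l x = g (joint (fun j : 'I_k => f (i j)) x)).
Proof.
move=> Uop Ux0 fC1 [V0 _ Vrank] iinj find.
have f1 j : C1_around (f j) x0 by exact: C1_near_around (fC1 j).
have fd j : differentiable (f j) x0 := (nbhs_singleton (f1 j)).1.
have [e dual] := dual_vectors (fun j => linearP ('d (f (i j)) x0)) find.
split=> [kk|_ l _].
  (* An injection of ['I_k] into itself is bijective; its inverse reindexes the dual vectors to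
     match [f]. *)
  subst kappa; have [i' iK i'K] := injF_bij iinj.
  apply: (@dual_functionally_independent _ _ _ _ _ _ (e \o i')) => // a b /=.
  by rewrite -{1}(i'K a) dual (inj_eq (can_inj i'K)).
have G1 j : C1_around (f (i j)) x0 by exact: f1.
have Gc j (eta : R) : 0 < eta -> \forall x \near x0, forall h,
    `|'d (f (i j)) x h - 'd (f (i j)) x0 h| <= eta * `|h|.
  exact: (nbhs_singleton (G1 j)).2.
(* The coefficient bound applied to a vanishing combination shows that the chosen differentials stay
   independent at [x], where the rank is still [k]. *)
have span : \forall x \near x0, exists c : 'I_k -> R,
    forall h, 'd (f l) x h = \sum_j c j * 'd (f (i j)) x h.
  apply: filterS2 V0 (near_dual_coef_bound Gc dual) => x Vx cx.
  apply: constant_rank_span (Vrank _ Vx).2 _ => c c0 j.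
  have Nc : \sum_j `|c j| <= 0.
    rewrite (le_trans (cx c))// big1 ?mulr0// => b _.
    have := congr1 (fun u => u (e b)) c0.
    by rewrite fct_sumE => /= cb; apply/eqP; rewrite normr_eq0; apply/eqP.
  apply/eqP; rewrite -normr_le0 (le_trans _ Nc)//.
  by rewrite (bigD1 j)//= lerDl sumr_ge0.
(* Coefficients are made total, with value 0 where none exist, so that [choice] yields functions on
   all of [E]. *)
have coef x : exists c : 'I_k -> R,
    (exists c' : 'I_k -> R, forall h, 'd (f l) x h = \sum_j c' j * 'd (f (i j)) x h) ->
    forall h, 'd (f l) x h = \sum_j c j * 'd (f (i j)) x h.
  have [[c cP]|nc] := pselect (exists c : 'I_k -> R,
    forall h, 'd (f l) x h = \sum_j c j * 'd (f (i j)) x h); first by exists c.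
  by exists (fun=> 0).
have [a aP] := choice coef.
have fG : \forall x \near x0, forall h,
    'd (f l) x h = \sum_j a x j * 'd (f (i j)) x h by exact: filterS span.
have ac := @near_coefficients_continuous R E k (fun j => f (i j)) (f l) x0 e
  (fun j x => a x j) G1 (f1 l) dual fG.
have Gd j : \forall x \near x0, differentiable (f (i j)) x.
  by apply: filterS (G1 j) => x [].
have fld : \forall x \near x0, differentiable (f l) x.
  by apply: filterS (f1 l) => x [].
have [g [gC1 fg]] := constant_rank_factorization Gd Gc dual fld fG ac.
split; last by exists g.
exact: graph_functionally_dependent (open_nbhs_nbhs (conj Uop Ux0)) gC1 fg.
Qed.
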